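(* Let $\theta_B\approx 2.35526$ be the unique real root of $x^7-2x^6-x^4-x^3-2x^2-2x-1$. For every $\varepsilon>0$ there exist real numbers $\delta_1,\delta_2$ with $0<\delta_1<\delta_2<\varepsilon$ such that every real number $\gamma\in[\theta_B+\delta_1,\theta_B+\delta_2]$ is the growth rate of some permutation class.
   Context: A permutation of length $n$ is a sequence containing each element of $\{1,\dots,n\}$ exactly once. A permutation $\tau$ of length $k$ is a subpermutation of $\sigma$ if $\sigma$ has a subsequence of length $k$ whose terms are in the same relative order as those of $\tau$. A permutation class is a set of permutations closed downward under the subpermutation order. For a class $\mathcal{C}$, $\mathcal{C}_n$ denotes its members of length $n$, and ''$\gamma$ is the growth rate of $\mathcal{C}$'' means that $\lim_{n\to\infty}|\mathcal{C}_n|^{1/n}$ exists and equals $\gamma$. *)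

(* Defs.v *)
From HB Require Import structures.
From mathcomp Require Import all_boot all_order all_algebra.
From mathcomp Require Import all_classical all_reals all_analysis.
Set Implicit Arguments. Unset Strict Implicit. Unset Printing Implicit Defensive.
Import Order.TTheory GRing.Theory Num.Theory.
Import numFieldNormedType.Exports.

Definition is_perm (s : seq nat) : Prop := perm_eq s (iota 1 (size s)).

Definition subperm_of (t s : seq nat) : Prop :=
  exists m : bitseq, size m = size s /\
    let u := mask m s in
    size u = size t /\
    forall i j, (i < size t)%N -> (j < size t)%N ->
      ((nth 0 u i < nth 0 u j)%N = (nth 0 t i < nth 0 t j)%N).

Definition perm_class (C : pred (seq nat)) : Prop :=
  (forall s, C s -> is_perm s) /\
  (forall s t, C s -> is_perm t -> subperm_of t s -> C t).

Definition class_count (C : pred (seq nat)) (n : nat) : nat :=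
  count C (permutations (iota 1 n)).

Local Open Scope ring_scope.
Local Open Scope classical_set_scope.

Definition growth_rate_of (R : realType) (C : pred (seq nat)) (gamma : R) : Prop :=
  let u : R^nat := fun n => ((class_count C n)%:R : R) `^ (n%:R^-1) in
  u @ \oo --> gamma.

Definition thetaB_poly (R : realType) (x : R) : R :=
  x ^+ 7 - 2 * x ^+ 6 - x ^+ 4 - x ^+ 3 - 2 * x ^+ 2 - 2 * x - 1.

(* Main.v *)
(** A sum-closed class whose sum-indecomposables are counted by [s_n] has growth rate the number
    [g] with [\sum_n s_n g^-n = 1].  The sum-indecomposables used here are increasing oscillations
    (their inversion graph is a path) in which the ends that are left-to-right maxima are inflated by
    increasing sequences of lengths [p, q <= 4].  Taking only the pairs with [min p q <= 1] gives
    the counting sequence 1, 1, 2, 3, 5, 7, 8, 8, 8, ..., whose growth rate is exactly [thetaB].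
    For every long enough path one may moreover add any down-closed set of pairs
    [p, q] in {2, 3, 4}; the possible contributions are digits in an expansion in base [g ^ 2],
    and the digit gaps are small enough for a greedy expansion to reach every real number in a
    whole interval.  Starting the choice at longer and longer paths gives intervals of growth
    rates that approach [thetaB] from above. *)
Require Import Defs.
From HB Require Import structures.
From mathcomp Require Import all_boot all_order all_algebra.
From mathcomp Require Import all_classical all_reals all_analysis.
From mathcomp Require Import zify ring lra.
Set Implicit Arguments. Unset Strict Implicit. Unset Printing Implicit Defensive.
Import Order.TTheory GRing.Theory Num.Theory.
Import numFieldNormedType.Exports.

(** * Standardization and direct sums *)

(* Ties are broken from left to right, so [before w] is a total order on positions. *)
Definition before (w : seq nat) (i j : nat) : bool :=
  (nth 0 w i < nth 0 w j) || ((nth 0 w i == nth 0 w j) && (i <= j)).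

Definition std (w : seq nat) : seq nat :=
  mkseq (fun j => count (before w ^~ j) (iota 0 (size w))) (size w).

Lemma size_std w : size (std w) = size w.
Proof. by rewrite size_mkseq. Qed.

Lemma nth_std w j : j < size w ->
  nth 0 (std w) j = count (before w ^~ j) (iota 0 (size w)).
Proof. exact: nth_mkseq. Qed.

Lemma count_ltn (T : eqType) (a b : pred T) (s : seq T) (x : T) :
  {subset a <= b} -> x \in s -> b x -> ~~ a x -> count a s < count b s.
Proof.
move=> ab xs bx nax; have sub : subpred (predU a (pred1 x)) b.
  by move=> y /= /orP[/ab|/eqP ->].
have := sub_count sub s; apply: leq_trans.
have := count_predUI a (pred1 x) s.
have -> : count (predI a (pred1 x)) s = 0.
  rewrite (eq_count (a2 := pred0)) ?count_pred0 // => y /=.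
  by case: eqP => [->|]; rewrite ?andbF ?andbT // (negbTE nax).
have : 0 < count (pred1 x) s by rewrite -has_count has_pred1.
lia.
Qed.

Lemma std_ltn w i j : i < size w -> before w i j -> i != j ->
  j < size w -> nth 0 (std w) i < nth 0 (std w) j.
Proof.
move=> iw bij neij jw; rewrite !nth_std //; apply: (@count_ltn _ _ _ _ j).
- move=> l; rewrite /before /in_mem /=; move: bij; rewrite /before.
  lia.
- by rewrite mem_iota.
- by rewrite /before eqxx leqnn orbT.
- by move: bij neij; rewrite /before; lia.
Qed.

Lemma before_std w i j : i < size w -> j < size w ->
  before (std w) i j = before w i j.
Proof.
move=> iw jw; have [->|ne] := eqVneq i j; first by rewrite /before !eqxx !leqnn !orbT.
case: (boolP (before w i j)) => [b|nb].
  by rewrite /before (std_ltn iw b ne jw).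
have b : before w j i by move: nb; rewrite /before; lia.
have := std_ltn jw b; rewrite eq_sym ne => /(_ isT iw).
by rewrite /before; lia.
Qed.

Lemma is_perm_std w : is_perm (std w).
Proof.
have uw : uniq (std w).
  apply/(uniqP 0) => i j; rewrite !inE size_std => iw jw e.
  apply/eqP; apply/negPn/negP => ne.
  case: (boolP (before w i j)) => [b|nb].
    by have := std_ltn iw b ne jw; rewrite e ltnn.
  have b : before w j i by move: nb; rewrite /before; lia.
  by have := std_ltn jw b; rewrite eq_sym ne e ltnn => /(_ isT iw).
have sub : {subset std w <= iota 1 (size (std w))}.
  move=> x /(nthP 0)[j]; rewrite size_std => jw <-; rewrite nth_std // mem_iota.
  have := count_size (before w ^~ j) (iota 0 (size w)); rewrite size_iota.
  have : 0 < count (before w ^~ j) (iota 0 (size w)).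
    rewrite -has_count; apply/hasP; exists j; first by rewrite mem_iota.
    by rewrite /before eqxx leqnn orbT.
  lia.
have [//|_ mm] := uniq_min_size uw sub _; first by rewrite size_iota.
by apply: uniq_perm => //; exact: iota_uniq.
Qed.

Lemma count_leq_iota v n : v <= n -> count (fun x => x <= v) (iota 1 n) = v.
Proof.
move=> vn; rewrite -(subnKC vn) iotaD count_cat (eq_in_count (a2 := predT)).
  rewrite count_predT size_iota (eq_in_count (a2 := pred0)) ?count_pred0 ?addn0 //.
  by move=> x; rewrite mem_iota /=; lia.
by move=> x; rewrite mem_iota /=; lia.
Qed.

Lemma std_perm s : is_perm s -> std s = s.
Proof.
move=> ps; have us : uniq s by rewrite (perm_uniq ps) iota_uniq.
apply: (@eq_from_nth _ 0); first by rewrite size_std.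
move=> j; rewrite size_std => js; rewrite nth_std //.
have -> : count (before s ^~ j) (iota 0 (size s)) =
          count (fun x => x <= nth 0 s j) s.
  rewrite -[X in _ = count _ X](mkseq_nth 0 s) /mkseq count_map; apply: eq_in_count => i.
  rewrite mem_iota /= add0n => iis; have := nth_uniq 0 iis js us.
  rewrite /before; have [->|] := eqVneq i j; first by rewrite eqxx !leqnn orbT.
  by move=> _; move: (nth 0 s i) (nth 0 s j) => a b; lia.
rewrite (permP ps) count_leq_iota //.
have : nth 0 s j \in iota 1 (size s) by rewrite -(perm_mem ps) mem_nth.
by rewrite mem_iota; lia.
Qed.

Lemma eq_std u v : size u = size v ->
  (forall i j, i < size u -> j < size u -> before u i j = before v i j) ->
  std u = std v.
Proof.
move=> suv e; apply: (@eq_from_nth _ 0); first by rewrite !size_std.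
move=> j; rewrite size_std => ju; rewrite !nth_std -?suv //.
by apply: eq_in_count => i; rewrite mem_iota /= => ii; apply: e.
Qed.

(** Closure under subpermutations becomes a statement about standardized masks, so it can be proved
    on words with repeated letters. *)
Lemma subperm_std t s : is_perm t -> subperm_of t s ->
  exists m, size m = size s /\ t = std (mask m s).
Proof.
move=> pt [m [sm [su e]]]; exists m; split => //.
rewrite -{1}(std_perm pt); apply: eq_std => // i j it jt.
have ut : uniq t by rewrite (perm_uniq pt) iota_uniq.
have E1 := e i j it jt; have E2 := e j i jt it.
have := nth_uniq 0 it jt ut; move: E1 E2; rewrite /before.
by have [->|] := eqVneq i j; lia.
Qed.

Definition dsum (s t : seq nat) : seq nat := s ++ map (addn (size s)) t.

Lemma size_dsum s t : size (dsum s t) = size s + size t.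
Proof. by rewrite size_cat size_map. Qed.

Lemma dsum0s s : dsum [::] s = s.
Proof. by rewrite /dsum /= (eq_map (g := id)) ?map_id. Qed.

Lemma dsums0 s : dsum s [::] = s.
Proof. exact: cats0. Qed.

Lemma dsumA r s t : dsum r (dsum s t) = dsum (dsum r s) t.
Proof.
rewrite /dsum map_cat catA -map_comp size_cat size_map; congr (_ ++ _).
by apply: eq_map => x /=; rewrite addnA.
Qed.

Lemma is_perm_dsum s t : is_perm s -> is_perm t -> is_perm (dsum s t).
Proof.
move=> ps pt; rewrite /is_perm size_dsum iotaD; apply: perm_cat => //.
by rewrite addnC iotaDl perm_map.
Qed.

Lemma perm_bounds s x : is_perm s -> x \in s -> 0 < x <= size s.
Proof. by move=> ps; rewrite (perm_mem ps) mem_iota; lia. Qed.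

(** Weak inequalities suffice: a tie between a letter of [u] and one of [v] is broken in favour of
    the earlier position, hence of [u]. *)
Lemma std_cat (u v : seq nat) : {in u & v, forall x y, x <= y} ->
  std (u ++ v) = dsum (std u) (std v).
Proof.
move=> uv; have pd := is_perm_dsum (is_perm_std u) (is_perm_std v).
rewrite -[RHS]std_perm //; apply: eq_std.
  by rewrite size_dsum !size_std size_cat.
have eqn i j : i < size u + size v -> i < size u -> ~~ (j < size u) -> j < size u + size v ->
    nth 0 u i <= nth 0 v (j - size u) /\
    nth 0 (std u) i < size u + nth 0 (std v) (j - size u).
  move=> _ iu ju jv; have jv' : j - size u < size v by lia.
  split; first by apply: uv; apply: mem_nth.
  have : 0 < nth 0 (std u) i <= size u.
    by rewrite -[size u]size_std; apply: perm_bounds; [exact: is_perm_std|rewrite mem_nth ?size_std].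
  have : 0 < nth 0 (std v) (j - size u) <= size v.
    rewrite -[size v]size_std; apply: perm_bounds; [exact: is_perm_std|by apply: mem_nth; rewrite size_std].
  lia.
move=> i j; rewrite size_cat => iuv juv.
rewrite /before /dsum !nth_cat !size_std.
have nm l : ~~ (l < size u) -> l < size u + size v ->
    nth 0 [seq size u + x | x <- std v] (l - size u) = size u + nth 0 (std v) (l - size u).
  by move=> lu luv; rewrite (nth_map 0) // size_std; lia.
case: (boolP (i < size u)) => iu; case: (boolP (j < size u)) => ju.
- exact/esym/before_std.
- by have [] := eqn i j iuv iu ju juv; rewrite nm //; lia.
- by have [] := eqn j i juv ju iu iuv; rewrite nm //; lia.
- have := @before_std v (i - size u) (j - size u).
  have iv : i - size u < size v by lia.
  have jv : j - size u < size v by lia.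
  by move=> /(_ iv jv); rewrite /before !nm //; lia.
Qed.

Lemma std_map_addn a w : std (map (addn a) w) = std w.
Proof.
apply: eq_std; rewrite ?size_map // => i j iw jw.
by rewrite /before !(nth_map 0) // ltn_add2l eqn_add2l.
Qed.

Lemma before_del x c y i j :
  before (x ++ y) i j =
  before (x ++ c :: y) (bump (size x) i) (bump (size x) j).
Proof.
have e l : nth 0 (x ++ c :: y) (bump (size x) l) = nth 0 (x ++ y) l.
  rewrite /bump !nth_cat; case: (leqP (size x) l) => lx /=.
    have -> : 1 + l < size x = false by lia.
    by rewrite -addnBA.
  by rewrite add0n lx.
by rewrite /before !e leq_bump2.
Qed.

(** Deleting a position is compatible with standardization. This moves a deletion from a permutation
    to any word that standardizes to it, where the path is visible. *)
Lemma eq_std_del x c y x' c' y' : size x = size x' ->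
  std (x ++ c :: y) = std (x' ++ c' :: y') -> std (x ++ y) = std (x' ++ y').
Proof.
move=> sx e; have sz : size (x ++ c :: y) = size (x' ++ c' :: y').
  by rewrite -size_std e size_std.
apply: eq_std; first by move: sz; rewrite !size_cat /=; lia.
move=> i j iu ju; rewrite (before_del x c) (before_del x' c') -sx.
have b l : l < size (x ++ y) -> bump (size x) l < size (x ++ c :: y).
  rewrite !size_cat /= /bump; by case: (size x <= l); lia.
by rewrite -before_std ?b // e before_std // -sz b.
Qed.

(** * Inflated oscillations *)

Lemma cat_split (u v x y : seq nat) c : u ++ v = x ++ c :: y ->
  (exists2 y', u = x ++ c :: y' & y = y' ++ v) \/
  (exists2 x', x = u ++ x' & v = x' ++ c :: y).
Proof.
elim: u x => [|a u IH] [|b x] //=.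
- by move=> ->; right; exists [::].
- by move=> ->; right; exists (b :: x).
- by case=> <- <-; left; exists u.
- case=> <- /IH [[y' -> ->]|[x' -> ->]]; first by left; exists y'.
  by right; exists x'.
Qed.

Lemma nseq_del q (b : nat) x c y : nseq q b = x ++ c :: y ->
  exists2 q', q = q'.+1 & x ++ y = nseq q' b.
Proof.
elim: x q => [|d x IH] [|q] //=; first by case=> _ <-; exists q.
by case=> <- /IH [q' -> ->]; exists q'.+1.
Qed.

(* In [osc k p q] below, the path has vertices 0, ..., 2k + 2, with vertex 0 repeated [p] times
   and vertex 2k + 2 repeated [q] times (possibly 0 times).  They are listed by position, in the
   order 0, 2, 1, 4, 3, ..., 2k + 2, 2k + 1, and the letter of [v] is [v + 1] if [v] is even and
   [v - 1] if [v] is odd: consecutive vertices, and only these, form inversions. *)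
Fixpoint osc_tail (a k q : nat) : seq nat :=
  if k is k'.+1 then (a + 3) :: a :: osc_tail (a + 2) k' q
  else rcons (nseq q (a + 3)) a.

(** The letters of [osc_tail] before its run of [q] equal letters: what stays to the left of the
    place where a path is cut. *)
Fixpoint osc_head (a k : nat) : seq nat :=
  if k is k'.+1 then (a + 3) :: a :: osc_head (a + 2) k' else [::].

Definition osc (k p q : nat) : seq nat := nseq p 1 ++ osc_tail 0 k q.

Lemma size_osc k p q : size (osc k p q) = p + q + k.*2 + 1.
Proof.
have st a : size (osc_tail a k q) = q + k.*2 + 1.
  elim: k a => [|k IH] a /=; first by rewrite size_rcons size_nseq; lia.
  by rewrite IH; lia.
by rewrite size_cat size_nseq st; lia.
Qed.

Lemma osc_head_tail a k : osc_head a k.+1 = osc_tail a k 1.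
Proof. by elim: k a => [|k IH] a //; rewrite /= -IH. Qed.

Lemma osc_tail_addn b a k q :
  osc_tail (b + a) k q = map (addn b) (osc_tail a k q).
Proof.
elim: k a => [|k IH] a /=; first by rewrite map_rcons map_nseq addnA.
by rewrite -IH !addnA.
Qed.

Lemma osc_tail_le a k q : {in osc_tail a k q, forall x, x <= a + k.*2 + 1 + (0 < q).*2}.
Proof.
elim: k a => [|k IH] a x /=.
  by rewrite mem_rcons inE mem_nseq; case: (q) => [|q'] /=; lia.
by rewrite !inE => /or3P[/eqP->|/eqP->|/IH]; lia.
Qed.

Lemma osc_le k p q : {in osc k p q, forall x, x <= k.*2 + 1 + (0 < q).*2}.
Proof.
move=> x; rewrite mem_cat mem_nseq => /orP[/andP[_ /eqP->]|/osc_tail_le]; lia.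
Qed.

(** The deleted letter is a copy of the last vertex, or the final letter, whose loss isolates the
    run of [q] equal letters, or an inner vertex, which cuts the path in two. In the last case it
    belongs to the pair numbered [j]: without the lower letter, the upper one becomes a simple left
    end of the second piece; without the upper letter, the lower one closes the first piece. *)
Lemma osc_tail_del a k q x c y : osc_tail a k q = x ++ c :: y ->
  [\/ exists2 q', q = q'.+1 & x ++ y = osc_tail a k q',
      x ++ y = osc_head a k ++ nseq q (a + k.*2 + 3) |
      exists j k', k = j + k'.+1 /\
        (x ++ y = osc_head a j ++ (a + j.*2 + 3) :: osc_tail (a + j.*2 + 2) k' q \/
         x ++ y = osc_tail a j 0 ++ osc_tail (a + j.*2 + 2) k' q)].
Proof.
elim: k a x => [|k IH] a x /=.
  case/lastP: y => [|y d].
    rewrite cats1 => /rcons_inj[<- _]; constructor 2.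
    by rewrite cats0 addn0.
  rewrite -rcons_cons -rcons_cat => /rcons_inj[/nseq_del[q' -> e] <-].
  by constructor 1; exists q' => //; rewrite -e rcons_cat.
case: x => [|b [|b' x]] /=.
- case=> _ <-; constructor 3; exists 0, k; split => //; right.
  by rewrite /= addn0.
- case=> <- _ <-; constructor 3; exists 0, k; split => //; left.
  by rewrite /= addn0.
case=> <- <- /IH[[q' -> ->]|->|[j [k' [-> e]]]].
- by constructor 1; exists q'.
- by constructor 2; congr (_ :: _ :: _ ++ nseq _ _); lia.
constructor 3; exists j.+1, k'; split => //.
have -> : a + j.+1.*2 = a + 2 + j.*2 by lia.
by case: e => ->; [left|right].
Qed.

(* [(p, q)] records the multiplicities of the two ends of a path. *)
Definition base_pairs : seq (nat * nat) :=
  [seq pq <- [seq (p, q) | p <- iota 0 5, q <- iota 0 5] | minn pq.1 pq.2 <= 1].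

(** Selected down-closed sets, in increasing order of contribution; each nonempty one contains (2,
    2) and (2, 3). Index 0 and every index out of range mean no extra pair. *)
Definition ext_pairs (o : nat) : seq (nat * nat) :=
  nth [::]
    [:: [::];
        [:: (2, 2); (2, 3)];
        [:: (2, 2); (2, 3); (2, 4)];
        [:: (2, 2); (2, 3); (3, 2)];
        [:: (2, 2); (2, 3); (3, 2); (2, 4)];
        [:: (2, 2); (2, 3); (3, 2); (2, 4); (3, 3)];
        [:: (2, 2); (2, 3); (3, 2); (2, 4); (3, 3); (4, 2)];
        [:: (2, 2); (2, 3); (3, 2); (2, 4); (3, 3); (4, 2); (3, 4)];
        [:: (2, 2); (2, 3); (3, 2); (2, 4); (3, 3); (4, 2); (3, 4); (4, 3)];
        [:: (2, 2); (2, 3); (3, 2); (2, 4); (3, 3); (4, 2); (3, 4); (4, 3); (4, 4)]] o.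

(* For [k = 0] the path is a star with [p + q] leaves, so [p = 0] is imposed to list each
   permutation once. *)
Definition end_pairs (opt : nat -> nat) (k : nat) : seq (nat * nat) :=
  if k is 0 then [seq (0, r) | r <- iota 0 6] else base_pairs ++ ext_pairs (opt k).

Lemma ext_pairsP (P : seq (nat * nat) -> bool) o :
  all (fun o => P (ext_pairs o)) (iota 0 11) -> P (ext_pairs o).
Proof.
move=> /allP h; have [lo|] := leqP o 10; first by apply: h; rewrite mem_iota.
by move=> go; rewrite /ext_pairs nth_default; [exact: (h 0)|exact: ltnW].
Qed.

Lemma uniq_end_pairs opt k : uniq (end_pairs opt k).
Proof. by case: k => [|k] //; apply: (@ext_pairsP (fun l => uniq (base_pairs ++ l))). Qed.

Lemma end_pairs_pred opt k p q : (p, q) \in end_pairs opt k ->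
  (p.-1, q) \in end_pairs opt k /\ (p, q.-1) \in end_pairs opt k.
Proof.
pose D l := all (fun pq : nat * nat => ((pq.1.-1, pq.2) \in l) && ((pq.1, pq.2.-1) \in l)) l.
suff /allP h : D (end_pairs opt k) by move=> /h /andP[].
by case: k => [|k] //; apply: (@ext_pairsP (fun l => D (base_pairs ++ l))).
Qed.

Lemma end_pairs_le opt k p q : (p, q) \in end_pairs opt k ->
  p <= 4 /\ q <= 4 + (k == 0).
Proof.
pose D k l := all (fun pq : nat * nat => (pq.1 <= 4) && (pq.2 <= 4 + (k == 0))) l.
suff /allP h : D k (end_pairs opt k) by move=> /h /andP[].
by case: k => [|k] //; apply: (@ext_pairsP (fun l => D k.+1 (base_pairs ++ l))).
Qed.

Lemma mem_base_pairs p q : p <= 4 -> q <= 4 -> minn p q <= 1 -> (p, q) \in base_pairs.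
Proof.
move=> p4 q4 m; rewrite mem_filter; apply/andP; split=> //.
by apply/allpairsP; exists (p, q); rewrite !mem_iota.
Qed.

(** * The sum-closed class and its closure under deletion *)

Inductive osc_class (opt : nat -> nat) : seq nat -> Prop :=
| osc_class_nil : osc_class opt [::]
| osc_class_dsum k p q r : (p, q) \in end_pairs opt k -> osc_class opt r ->
    osc_class opt (dsum (std (osc k p q)) r).

Section OscClass.
Variable opt : nat -> nat.
Local Notation good w := (osc_class opt (std w)).

Lemma osc_class_perm s : osc_class opt s -> is_perm s.
Proof.
by elim=> // k p q r _ _; apply: is_perm_dsum; exact: is_perm_std.
Qed.

Lemma osc_class_cat s t : osc_class opt s -> osc_class opt t -> osc_class opt (dsum s t).
Proof.
move=> cs ct; elim: cs => [|k p q r kpq _ IH]; first by rewrite dsum0s.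
by rewrite -dsumA; apply: osc_class_dsum.
Qed.

Lemma good_cat (u v : seq nat) : {in u & v, forall x y, x <= y} ->
  good u -> good v -> good (u ++ v).
Proof. by move=> uv gu gv; rewrite std_cat //; exact: osc_class_cat. Qed.

Lemma good_osc k p q : (p, q) \in end_pairs opt k -> good (osc k p q).
Proof.
by move=> h; rewrite -[std _]dsums0; apply: osc_class_dsum => //; exact: osc_class_nil.
Qed.

Lemma good_nseq n a : good (nseq n a).
Proof.
elim: n => [|n IH]; first exact: osc_class_nil.
rewrite -[nseq _ _]/([:: a] ++ nseq n a); apply: good_cat => //.
  by move=> x y; rewrite inE mem_nseq => /eqP-> /andP[_ /eqP->].
rewrite -[a]addn0 -[[:: a + 0]]/(map (addn a) [:: 0]) std_map_addn.
exact: (@good_osc 0 0 0).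
Qed.

(** For [k = 0] the nonzero letters are weakly increasing and all precede the 0, so only their
    number matters. *)
Lemma std_star p q : std (osc 0 p q) = std (osc 0 0 (p + q)).
Proof.
apply: eq_std; first by rewrite !size_osc; lia.
have e p' q' i : i < p' + q' + 1 -> nth 0 (osc 0 p' q') i =
    if i < p' then 1 else if i < p' + q' then 3 else 0.
  move=> ii; rewrite /osc nth_cat size_nseq nth_nseq /= nth_rcons size_nseq nth_nseq.
  by repeat case: ifP; lia.
move=> i j; rewrite size_osc => iw jw; rewrite /before !e; try lia.
by repeat case: ifP; lia.
Qed.

Lemma good_base k p q : p <= 4 -> q <= 4 -> minn p q <= 1 -> good (osc k p q).
Proof.
move=> p4 q4 m; case: k => [|k].
  (* One multiplicity is at most 1 and the other at most 4, so [p + q <= 5]: this is the range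
     [iota 0 6] allowed for stars. *)
  by rewrite std_star; apply: good_osc; apply/mapP; exists (p + q); rewrite ?mem_iota //; lia.
by apply: good_osc; rewrite mem_cat mem_base_pairs.
Qed.

Lemma osc_shift b k q p : nseq p (b + 1) ++ osc_tail b k q = map (addn b) (osc k p q).
Proof. by rewrite /osc map_cat map_nseq -osc_tail_addn addn0. Qed.

(** This is why all pairs with [minn p q <= 1] are allowed at every length: cutting a path leaves
    pieces whose new end has multiplicity 0 or 1, whatever the old end is, or a run of equal
    letters, which is a sum of singletons. Shortening an end stays among the allowed pairs because
    these are down-closed. *)
Lemma good_osc_del k p q x c y : (p, q) \in end_pairs opt k ->
  osc k p q = x ++ c :: y -> good (x ++ y).
Proof.
move=> kpq; have [[gp gq] [p4 q4]] := (end_pairs_pred kpq, end_pairs_le kpq).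
have cut u b l s : good u -> {in u, forall x, x <= b} -> l = map (addn b) s ->
    good s -> good (u ++ l).
  move=> gu ub -> gs; apply: good_cat; rewrite ?std_map_addn // => i j /ub ib.
  by case/mapP => z _ ->; rewrite (leq_trans ib) ?leq_addr.
move=> /cat_split[[y' /nseq_del[p' pE e] ->]|[x' -> e]].
  by rewrite catA e; move: gp; rewrite pE; exact: good_osc.
rewrite -catA; have {e} [[q' qE ->]|->|[j [k' [kE e]]]] := osc_tail_del e.
- by move: gq; rewrite qE; exact: good_osc.
- have sh b : nseq q (b + 3) = map (addn (b + 3)) (nseq q 0).
    by rewrite map_nseq addn0.
  case: k {kpq q4 gp gq} sh => [|k] sh.
    apply: good_cat; rewrite ?good_nseq //; last exact: good_nseq.
    + by move=> i j; rewrite !mem_nseq => /andP[_ /eqP->] /andP[_ /eqP->].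
    + exact: good_nseq.
  rewrite osc_head_tail catA; apply: (cut _ _ _ _ _ _ (sh _)); last exact: good_nseq.
    by apply: good_base => //; rewrite geq_min orbT.
  by move=> z /osc_le; rewrite doubleS add0n; lia.
have q4' : q <= 4 by move: q4; rewrite kE addnS addn0.
case: e => ->.
  rewrite catA; apply: (cut _ (j.*2 + 2) _ (osc k' 1 q)).
  + case: j {kE} => [|j]; first by rewrite cats0; exact: good_nseq.
    by rewrite osc_head_tail; apply: good_base => //; rewrite geq_min orbT.
  + case: j {kE} => [|j].
      by rewrite cats0 => z; rewrite mem_nseq => /andP[_ /eqP->].
    by rewrite osc_head_tail => z /osc_le; lia.
  + by rewrite -osc_shift /= add0n -addnA.
  + by apply: good_base => //; rewrite geq_min.
rewrite catA; apply: (cut _ (j.*2 + 2) _ (osc k' 0 q)).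
+ by apply: good_base => //; rewrite geq_min orbT.
+ by move=> z /osc_le; lia.
+ by rewrite -osc_shift.
+ by apply: good_base => //; rewrite geq_min.
Qed.

Lemma osc_class_del s x c y : osc_class opt s -> s = x ++ c :: y -> good (x ++ y).
Proof.
move=> cs; elim: cs x c y => [|k p q r kpq cr IH] x c y; first by case: x.
have pb := is_perm_std (osc k p q); set b := std _ in pb *.
have bE : b = std (osc k p q) by [].
clearbody b.
move=> /cat_split[[y' be ->]|[x' -> re]].
  rewrite catA std_cat ?std_map_addn ?(std_perm (osc_class_perm cr)).
    apply: osc_class_cat => //.
    (* The deletion takes place in [std (osc k p q)]; it is carried to the same position of the word
       [osc k p q], where [good_osc_del] applies. *)
    have sz : size x < size (osc k p q) by rewrite -(size_std (osc k p q)) -bE be size_cat /=; lia.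
    have oe := esym (cat_take_drop (size x) (osc k p q)).
    rewrite (drop_nth 0 sz) in oe.
    have st : size (take (size x) (osc k p q)) = size x by rewrite size_takel // ltnW.
    have e : std b = std (osc k p q) by rewrite bE std_perm //; exact: is_perm_std.
    by rewrite be oe in e; rewrite (eq_std_del (esym st) e); exact: good_osc_del oe.
  move=> i j ii /mapP[z _ ->]; apply: leq_trans (leq_addr _ _).
  have /(perm_bounds pb) : i \in b; last by lia.
  by rewrite be; move: ii; rewrite !mem_cat inE => /orP[->|->]; rewrite ?orbT.
have sx : size x' < size r by rewrite -(size_map (addn (size b)) r) re size_cat /=; lia.
have := cat_take_drop (size x') r; rewrite (drop_nth 0 sx).
set x0 := take _ _; set c0 := nth _ _ _; set y0 := drop _ _ => rE.
have sx0 : size x0 = size x' by rewrite size_takel // ltnW.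
move: re; rewrite -{1}rE map_cat /= => /eqP; rewrite eqseq_cat ?size_map //.
case/andP=> /eqP <- /eqP[_ <-]; rewrite -catA -map_cat std_cat.
  rewrite std_map_addn std_perm // bE; apply: osc_class_dsum => //.
  exact: IH (esym rE).
move=> i j /(perm_bounds pb)/andP[_ ib] /mapP[z _ ->].
exact: leq_trans ib (leq_addr _ _).
Qed.

(** Induction on the number of dropped letters, deleting one position at a time. *)
Lemma good_mask m w : size m = size w -> good w -> good (mask m w).
Proof.
have [n] := ubnP (count negb m); elim: n m w => // n IH m w cn sm gw.
case: (boolP (false \in m)) => [|nf]; last first.
  suff -> : m = nseq (size w) true by rewrite mask_true.
  rewrite -sm; apply/all_pred1P/allP => -[] //; last by rewrite (negbTE nf).
move=> fm; case/splitPr: m / fm cn sm => m1 m2 cn sm.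
have s1 : size (take (size m1) w) = size m1.
  by rewrite size_takel // -sm size_cat leq_addr.
have lt1 : size m1 < size w by rewrite -sm size_cat /=; lia.
have := cat_take_drop (size m1) w; rewrite (drop_nth 0 lt1) => wE.
rewrite -wE mask_cat // mask_cons /= -mask_cat //; apply: IH.
- by move: cn; rewrite !count_cat /=; lia.
- by move: sm; rewrite -{1}wE !size_cat /=; lia.
have st : size (take (size m1) (std w)) = size (take (size m1) w).
  by rewrite !size_takel ?size_std // ltnW.
have := cat_take_drop (size m1) (std w); rewrite (drop_nth 0) ?size_std // => sE.
have e := etrans (congr1 std sE)
  (etrans (std_perm (is_perm_std w)) (esym (congr1 std wE))).
rewrite -(eq_std_del st e).
exact: osc_class_del gw (esym sE).
Qed.

Lemma osc_class_subperm s t : osc_class opt s -> is_perm t -> subperm_of t s ->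
  osc_class opt t.
Proof.
move=> cs pt /(subperm_std pt)[m [sm ->]]; apply: good_mask => //.
by rewrite std_perm //; exact: osc_class_perm.
Qed.

End OscClass.

(** * Unique decomposition into inflated oscillations *)

Definition indecomposable (b : seq nat) : Prop :=
  forall u v, b = u ++ v -> u != [::] -> v != [::] ->
    exists x y, [/\ x \in u, y \in v & y < x].

Lemma osc_tail_base a k q : a \in osc_tail a k q.
Proof. by case: k => [|k]; rewrite /= ?mem_rcons !inE eqxx ?orbT. Qed.

(** Consecutive vertices of the path form inversions, so every cut of the word is crossed by one. *)
Lemma indecomposable_osc k p q : indecomposable (osc k p q).
Proof.
have tl a x v : osc_tail a k q = x ++ v -> x != [::] -> v != [::] ->
    exists i j, [/\ i \in x, j \in v & j < i].
  elim: k a x => [|k IH] a x /=.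
    case: x => // b x; case/lastP: v => // v d.
    rewrite -rcons_cat => /rcons_inj[e <-] _ _; exists b, a.
    rewrite mem_rcons !inE !eqxx; split=> //.
    have : b \in nseq q (a + 3) by rewrite e inE eqxx.
    by rewrite mem_nseq => /andP[_ /eqP->]; lia.
  case: x => [|b [|b' x]] //=.
    case=> <- <- _ _; exists (a + 3), a; rewrite !inE !eqxx; split=> //; lia.
  case=> <- <-; case: x => [/= e|c x e] _ v0.
    exists (a + 3), (a + 2); rewrite -e osc_tail_base !inE eqxx; split=> //; lia.
  have [i [j [ix jv ji]]] := IH _ _ e isT v0.
  by exists i, j; rewrite !inE in ix *; rewrite ix !orbT.
elim: p => [|p IH] u v; first exact: tl.
case: u => // b u [<- e] _ v0; case: u e => [/= e|c u e].
  exists 1, 0; rewrite inE eqxx; split => //.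
  by rewrite -e mem_cat osc_tail_base orbT.
have [i [j [ix jv ji]]] := IH _ _ e isT v0.
by exists i, j; rewrite inE ix orbT.
Qed.

Lemma indecomposable_std w : indecomposable w -> indecomposable (std w).
Proof.
move=> iw u v e u0 v0; have sw : size w = size u + size v.
  by rewrite -size_cat -e size_std.
have su : 0 < size u by rewrite lt0n size_eq0.
have sv : 0 < size v by rewrite lt0n size_eq0.
have suw : size u <= size w by rewrite sw leq_addr.
have := iw _ _ (esym (cat_take_drop (size u) w)).
rewrite -!size_eq0 size_drop sw addKn -!lt0n size_takel // => /(_ su sv).
case=> x [y [/(nthP 0)[i]]]; rewrite size_takel //.
move=> iu; rewrite nth_take // => <- /(nthP 0)[j].
rewrite size_drop nth_drop sw addKn => jv <- ji.
exists (nth 0 (std w) i), (nth 0 (std w) (size u + j)); split.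
- by rewrite e nth_cat iu mem_nth.
- rewrite e nth_cat ltnNge leq_addr /= addKn mem_nth //.
- apply: std_ltn; rewrite /before ?ji ?sw //; lia.
Qed.

(** If one first summand were shorter, it would be a proper prefix of the other whose letters lie
    below all remaining ones, and no inversion would cross that cut. *)
Lemma dsum_inj b b' r r' : is_perm b -> is_perm b' ->
  indecomposable b -> indecomposable b' -> b != [::] -> b' != [::] ->
  dsum b r = dsum b' r' -> b = b' /\ r = r'.
Proof.
have shorter c c' s s' : is_perm c -> indecomposable c' -> c != [::] ->
    dsum c s = dsum c' s' -> ~~ (size c < size c').
  move=> pc ic' c0 e; apply/negP => lt.
  have c'E : c' = c ++ drop (size c) c'.
    have := congr1 (take (size c)) e; rewrite take_size_cat // takel_cat ?(ltnW lt) //.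
    by move=> cE; rewrite {1}cE cat_take_drop.
  have d0 : drop (size c) c' != [::] by rewrite -size_eq0 size_drop -lt0n subn_gt0.
  have [x [y [xc yd yx]]] := ic' _ _ c'E c0 d0.
  have : y \in drop (size c) (dsum c s).
    by rewrite e /dsum drop_cat lt mem_cat yd.
  rewrite drop_size_cat // => /mapP[z _ yE].
  have /andP[_ xb] := perm_bounds pc xc.
  by move: (leq_trans yx xb); rewrite yE ltnNge leq_addr.
move=> pb pb' ib ib' b0 b0' e.
have /eqP se : size b == size b'.
  by have := shorter _ _ _ _ pb ib' b0 e; have := shorter _ _ _ _ pb' ib b0' (esym e); lia.
move/eqP: e; rewrite eqseq_cat // => /andP[/eqP-> /eqP].
by move/(inj_map (@addnI _)).
Qed.

Lemma index_std_min (w : seq nat) : 0 \in w -> index 1 (std w) = index 0 w.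
Proof.
move=> w0; have iw : index 0 w < size w by rewrite index_mem.
have sw := leq_ltn_trans (leq0n _) iw.
have us : uniq (std w) by rewrite (perm_uniq (is_perm_std w)) iota_uniq.
have /(nthP 0)[j] : 1 \in std w by rewrite (perm_mem (is_perm_std w)) mem_iota size_std add1n ltnS.
rewrite size_std => jw j1; have [ij|ne] := eqVneq (index 0 w) j.
  by rewrite -j1 -{1}ij index_uniq ?size_std.
have b : before w (index 0 w) j.
  rewrite /before nth_index //; have [j0|] := eqVneq (nth 0 w j) 0; last by lia.
  by rewrite j0 ltnn /= leqNgt; apply/negP => /(before_find 0); rewrite /= j0.
have := std_ltn iw b ne jw; rewrite j1.
have /(perm_bounds (is_perm_std w)) : nth 0 (std w) (index 0 w) \in std w.
  by rewrite mem_nth ?size_std.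
by lia.
Qed.

Lemma last_std_rcons u a : last 0 (std (rcons u a)) = count (geq a) (rcons u a).
Proof.
rewrite -nth_last size_std size_rcons [_.-1]/= nth_std ?size_rcons //.
rewrite -[X in _ = count _ X](mkseq_nth 0) /mkseq count_map size_rcons.
apply: eq_in_count => i; rewrite mem_iota /= add0n => ii.
rewrite /before [nth 0 _ (size u)]nth_rcons ltnn eqxx.
by move: ii; rewrite ltnS => ->; rewrite andbT orbC -leq_eqVlt.
Qed.

Lemma index0_osc k p q : index 0 (osc k p q) = if k is 0 then p + q else p.+1.
Proof.
rewrite index_cat mem_nseq andbF size_nseq; case: k => [|k] /=; last by rewrite addn1.
by rewrite -cats1 index_cat mem_nseq andbF size_nseq /= addn0.
Qed.

Lemma last_std_osc k p q : 0 < k -> last 0 (std (osc k p q)) + q.+1 = size (osc k p q).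
Proof.
have tlE a : exists t, osc_tail a k q = rcons t (a + k.*2).
  elim: k a => [|k IH] a /=; first by exists (nseq q (a + 3)); rewrite addn0.
  have [t ->] := IH (a + 2); exists (a + 3 :: a :: t) => /=; congr (_ :: _ :: rcons _ _); lia.
have cnt a k' : count (ltn (a + k'.+1.*2)) (osc_tail a k'.+1 q) = q.+1.
  elim: k' a => [|k' IH] a.
    rewrite /= -cats1 count_cat count_nseq /=; lia.
  rewrite /= in IH *; have := IH (a + 2).
  have -> : a + 2 + k'.+1.*2 = a + k'.+2.*2 by lia.
  by move=> /= ->; lia.
case: k tlE => // k tlE _.
have [t tE] := tlE 0.
have oE : osc k.+1 p q = rcons (nseq p 1 ++ t) (0 + k.+1.*2) by rewrite rcons_cat -tE.
rewrite [in LHS]oE last_std_rcons -oE -(count_predC (geq (0 + k.+1.*2)) (osc _ _ _)).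
congr (_ + _); rewrite (eq_count (a2 := ltn (0 + k.+1.*2))).
  by rewrite /osc count_cat cnt count_nseq.
by move=> z /=; rewrite ltnNge.
Qed.

(** Three invariants recover the parameters: the length, the position of the letter 1 and the last
    letter. The 1 comes last exactly when [k = 0]. For [k > 0] its position gives [p], and exactly
    [q + 1] letters exceed the last one: the copies of the right end and the other neighbour of the
    last letter in the path. *)
Lemma std_osc_inj opt k p q k' p' q' :
  (p, q) \in end_pairs opt k -> (p', q') \in end_pairs opt k' ->
  std (osc k p q) = std (osc k' p' q') -> (k, (p, q)) = (k', (p', q')).
Proof.
move=> h h' e; have se := congr1 size e; rewrite !size_std !size_osc in se.
have z i j l : 0 \in osc i j l by rewrite mem_cat osc_tail_base orbT.
have := congr1 (index 1) e; rewrite !index_std_min // !index0_osc.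
have le := congr1 (last 0) e.
case: k k' h h' e se le => [|k] [|k'] h h' e se le.
- by case/mapP: h se => r _ [-> ->]; case/mapP: h' => r' _ [-> ->] /= ? _; congr (_, (_, _)); lia.
- by lia.
- by lia.
case=> pp; have := @last_std_osc k.+1 p q isT; have := @last_std_osc k'.+1 p' q' isT.
rewrite -le !size_osc => e1 e2.
have qq : q = q' by lia.
by congr (_, (_, _)) => //; lia.
Qed.

(** * Counting by the first summand *)

Definition osc_blocks opt n : seq (nat * (nat * nat)) :=
  [seq (k, pq) | k <- iota 0 n, pq <- end_pairs opt k].

Definition block_size (b : nat * (nat * nat)) : nat := b.2.1 + b.2.2 + b.1.*2 + 1.

Definition block_perm (b : nat * (nat * nat)) : seq nat := std (osc b.1 b.2.1 b.2.2).

Lemma size_block_perm b : size (block_perm b) = block_size b.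
Proof. by rewrite size_std size_osc. Qed.

Lemma mem_osc_blocks opt n k p q :
  ((k, (p, q)) \in osc_blocks opt n) = (k < n) && ((p, q) \in end_pairs opt k).
Proof.
apply/allpairsPdep/andP => [[k1 [pq [kn kpq [-> ->]]]]|[kn kpq]].
  by move: kn; rewrite mem_iota.
by exists k, (p, q); rewrite mem_iota.
Qed.

Lemma uniq_osc_blocks opt n : uniq (osc_blocks opt n).
Proof.
apply: allpairs_uniq_dep; first exact: iota_uniq.
  by move=> k _; exact: uniq_end_pairs.
by move=> [k1 pq1] [k2 pq2] _ _ /= [-> ->].
Qed.

Definition osc_pred (opt : nat -> nat) : pred (seq nat) := fun s => `[< osc_class opt s >].

Lemma perm_class_osc opt : perm_class (osc_pred opt).
Proof.
split=> [s /asboolP|s t /asboolP cs pt sub]; first exact: osc_class_perm.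
by apply/asboolP; exact: osc_class_subperm cs pt sub.
Qed.

Definition osc_members opt n : seq (seq nat) :=
  [seq s <- permutations (iota 1 n) | osc_pred opt s].

Lemma mem_osc_members opt n s :
  (s \in osc_members opt n) = osc_pred opt s && (size s == n).
Proof.
rewrite mem_filter mem_permutations; apply: andb_id2l => /asboolP/osc_class_perm ps.
apply/idP/eqP => [/perm_size|<-].
  by rewrite size_iota.
exact: ps.
Qed.

Lemma class_count_osc0 opt : class_count (osc_pred opt) 0 = 1.
Proof.
rewrite /class_count /= /osc_pred; case: asboolP => // h; case: h.
exact: osc_class_nil.
Qed.

(** Splitting off the first summand is a bijection by unique decomposition. Listing only path
    indices below [n] loses nothing, since a block of index [k] has size at least [2k + 1]. *)
Lemma class_count_osc opt n : 0 < n ->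
  class_count (osc_pred opt) n =
  \sum_(b <- osc_blocks opt n | block_size b <= n)
     class_count (osc_pred opt) (n - block_size b).
Proof.
move=> n0; pose bs := [seq b <- osc_blocks opt n | block_size b <= n].
pose F := [seq dsum (block_perm b) r | b <- bs, r <- osc_members opt (n - block_size b)].
have bE b : b \in bs -> [/\ block_size b <= n & b.2 \in end_pairs opt b.1].
  rewrite mem_filter => /andP[bn]; case: b bn => k [p q] bn.
  by rewrite mem_osc_blocks => /andP[].
have uF : uniq F.
  apply: allpairs_uniq_dep.
  - by rewrite filter_uniq // uniq_osc_blocks.
  - by move=> b _; rewrite filter_uniq // permutations_uniq.
  move=> [b r] [b' r'] /allpairsPdep[b1 [r1 [b1s _ [-> _]]]] /allpairsPdep[b2 [r2 [b2s _ [-> _]]]] /=.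
  have [_ e1] := bE _ b1s; have [_ e2] := bE _ b2s => e.
  have [] := @dsum_inj (block_perm b1) (block_perm b2) r r' _ _ _ _ _ _ e;
    rewrite -?size_eq0 ?size_block_perm /block_size ?addn1 //; do ?exact: is_perm_std;
    do ?exact/indecomposable_std/indecomposable_osc.
  move=> eb ->; case: b1 b2 {b1s b2s e} e1 e2 eb => k [p q] [k' [p' q']] /= e1 e2 eb.
  by have [-> -> ->] := std_osc_inj e1 e2 eb.
have FE : osc_members opt n =i F.
  move=> s; rewrite mem_osc_members; apply/andP/allpairsPdep.
    move=> [/asboolP cs /eqP sn]; case: cs sn => [|k p q r kpq cr]; first by move=> e; rewrite -e in n0.
    rewrite size_dsum size_std size_osc => sn.
    exists (k, (p, q)), r; split => //.
      rewrite mem_filter mem_osc_blocks kpq /block_size /=.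
      by lia.
    rewrite mem_osc_members; apply/andP; split; first exact/asboolP.
    by rewrite /block_size /=; lia.
  move=> [b [r [bb rr ->]]]; have [bn e] := bE _ bb.
  move: rr; rewrite mem_osc_members => /andP[/asboolP cr /eqP sr].
  split; last by rewrite size_dsum size_block_perm sr subnKC.
  by apply/asboolP/osc_class_dsum => //; case: (b.2) e.
rewrite /class_count -size_filter -/(osc_members opt n).
have uM : uniq (osc_members opt n) by rewrite filter_uniq // permutations_uniq.
rewrite (perm_size (uniq_perm uM uF FE)) size_allpairs_dep sumnE big_map big_filter.
by apply: eq_bigr => b _; rewrite size_filter.
Qed.

(** * Growth rates and expansions *)

Local Open Scope ring_scope.

Section Growth.
Variable R : realType.
Implicit Types (x y z g : R) (u : nat -> R).

Lemma exprn_unbounded x y : 1 < x -> exists n, y <= x ^+ n.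
Proof.
move=> x1; have bernoulli n : 1 + n%:R * (x - 1) <= x ^+ n.
  elim: n => [|n IH]; first by rewrite mul0r addr0 expr0.
  rewrite exprS -natr1; have n0 : (0 : R) <= n%:R := ler0n _ _.
  have h : x * (1 + n%:R * (x - 1)) <= x * x ^+ n by rewrite ler_pM2l //; lra.
  apply: le_trans h; have : 0 <= n%:R * (x - 1) * (x - 1).
    by rewrite !mulr_ge0 // subr_ge0 ltW.
  by nra.
have [n yn] : exists n : nat, y / (x - 1) <= n%:R.
  exists (Num.bound `|y / (x - 1)|); apply: ltW.
  exact: le_lt_trans (ler_norm _) (archi_boundP (normr_ge0 _)).
exists n; apply: le_trans (bernoulli n); rewrite ler_pdivrMr ?subr_gt0 // in yn.
by lra.
Qed.

Lemma root_cvg u g : 1 < g -> (forall n, 0 <= u n <= g ^+ n) ->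
  (forall b, 1 <= b < g -> exists N, forall n, b ^+ n <= u n * b ^+ N) ->
  ((fun n => u n `^ n%:R^-1) @ \oo --> g)%classic.
Proof.
move=> g1 ug ub; apply/cvgrPdist_le => e e0.
have rootE x n : 0 <= x -> (0 < n)%N -> (x ^+ n) `^ n%:R^-1 = x.
  by move=> x0 n0; rewrite -powR_mulrn // -powRrM mulfV ?powRr1 // pnatr_eq0 -lt0n.
pose d := Num.min e ((g - 1) / 2).
have d0 : 0 < d by rewrite lt_min e0 /=; lra.
have de : d <= e by rewrite ge_min lexx.
have dg : d <= (g - 1) / 2 by rewrite ge_min lexx orbT.
(* The intermediate base [g - d / 2] beats [g - d] by a ratio above 1, whose powers eventually
   absorb the constant [(g - d / 2) ^+ N]. *)
have [|N bN] := ub (g - d / 2); first by apply/andP; split; lra.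
have a0 : 0 < g - d by lra.
have [|n1 hn1] := @exprn_unbounded ((g - d / 2) / (g - d)) ((g - d / 2) ^+ N).
  by rewrite ltr_pdivlMr //; lra.
exists (maxn n1 1) => // n /=; rewrite geq_max => /andP[n1n n0].
have /andP[u0 un] := ug n.
have up : u n `^ n%:R^-1 <= g.
  rewrite -[leRHS](rootE _ n) //; last lra.
  by apply: ge0_ler_powR; rewrite ?nnegrE ?invr_ge0 ?ler0n // exprn_ge0 //; lra.
have lo : g - d <= u n `^ n%:R^-1.
  rewrite -[leLHS](rootE _ n) //; last lra.
  apply: ge0_ler_powR; rewrite ?nnegrE ?invr_ge0 ?ler0n ?exprn_ge0 //; first lra.
  have b0 : 0 < (g - d / 2) ^+ N by rewrite exprn_gt0 //; lra.
  rewrite -(ler_pM2r b0); apply: le_trans (bN n).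
  have : (g - d / 2) ^+ N <= ((g - d / 2) / (g - d)) ^+ n.
    apply: le_trans hn1 _; rewrite ler_weXn2l // ler_pdivlMr //; lra.
  rewrite expr_div_n ler_pdivlMr ?exprn_gt0 // mulrC; exact.
by rewrite ler_norml; apply/andP; split; lra.
Qed.

Definition block_series opt M z := \sum_(b <- osc_blocks opt M) z ^+ block_size b.

Lemma block_seriesS opt M z : block_series opt M.+1 z =
  block_series opt M z + z ^+ (M.*2 + 1) * \sum_(pq <- end_pairs opt M) z ^+ (pq.1 + pq.2).
Proof.
rewrite /block_series /osc_blocks !big_allpairs_dep -addn1 iotaD big_cat /= big_seq1.
congr (_ + _); rewrite mulr_sumr; apply: eq_bigr => pq _.
by rewrite -exprD /block_size /=; congr (_ ^+ _); lia.
Qed.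

Lemma le_block_series opt M N z : 0 <= z -> (M <= N)%N ->
  block_series opt M z <= block_series opt N z.
Proof.
move=> z0 /subnKC <-; elim: (N - M)%N => [|d IH]; first by rewrite addn0.
rewrite addnS block_seriesS; apply: le_trans IH _.
by rewrite lerDl mulr_ge0 ?exprn_ge0 // sumr_ge0 // => pq _; rewrite exprn_ge0.
Qed.

(** The one-letter block contributes [z] itself, so the series has slope at least 1. *)
Lemma block_series_incr opt M z y : 0 <= z -> z <= y -> (0 < M)%N ->
  block_series opt M z + (y - z) <= block_series opt M y.
Proof.
move=> z0 zy M0; have b0 : (0, (0, 0))%N \in osc_blocks opt M.
  by rewrite mem_osc_blocks M0.
rewrite /block_series !(bigD1_seq _ b0) ?uniq_osc_blocks //=.
rewrite /block_size /= !expr1 addrAC subrKC lerD2l.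
by apply: ler_sum => b _; rewrite lerXn2r ?nnegrE // (le_trans z0).
Qed.

Local Notation c opt n := ((class_count (osc_pred opt) n)%:R : R).

(** The powers of [g] are a supersolution of the counting recurrence as soon as no partial series
    exceeds 1 at [g^-1]. *)
Lemma class_count_le opt g : 0 < g -> (forall M, block_series opt M g^-1 <= 1) ->
  forall n, c opt n <= g ^+ n.
Proof.
move=> g0 h n; have [m] := ubnP n; elim: m n => // m IH n nm.
case: n nm => [|n] nm; first by rewrite class_count_osc0 expr0.
rewrite class_count_osc // natr_sum.
have -> : g ^+ n.+1 = g ^+ n.+1 * 1 by rewrite mulr1.
apply: (@le_trans _ _ (g ^+ n.+1 * block_series opt n.+1 g^-1)); last first.
  by rewrite ler_pM2l ?exprn_gt0.
rewrite /block_series mulr_sumr big_mkcond; apply: ler_sum => b _.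
case: ifP => bn; last by rewrite mulr_ge0 ?exprn_ge0 ?invr_ge0 // ltW.
have b1 : (0 < block_size b)%N by rewrite /block_size addn1.
apply: le_trans (IH _ _) _; first by lia.
by rewrite exprVn -expfB_cond // gt_eqF.
Qed.

Lemma class_count_ge1 opt n : (0 < class_count (osc_pred opt) n)%N.
Proof.
elim: n => [|n IH]; first by rewrite class_count_osc0.
rewrite class_count_osc // (big_rem (0, (0, 0))%N) ?mem_osc_blocks //=.
by rewrite /block_size /= subn1 addn_gt0 IH.
Qed.

Lemma class_count_ge opt M b : 1 <= b -> 1 <= block_series opt M b^-1 ->
  exists N, forall n, b ^+ n <= c opt n * b ^+ N.
Proof.
move=> b1 h; have b0 : 0 < b by lra.
(* No block of index below [M] is larger than [M.*2 + 8]. Beyond this length all of them enter the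
   recurrence; up to it the factor [b ^+ N] covers the initial values. *)
exists (M.*2 + 8)%N => n; have [m] := ubnP n; elim: m n => // m IH n nm.
have [nN|Nn] := leqP n (M.*2 + 8).
  apply: (@le_trans _ _ (1 * b ^+ (M.*2 + 8))); first by rewrite mul1r ler_weXn2l.
  by rewrite ler_pM2r ?exprn_gt0 // ler1n class_count_ge1.
have n0 : (0 < n)%N by lia.
have sz d : d \in osc_blocks opt M -> (block_size d <= n)%N.
  case: d => k [p q]; rewrite mem_osc_blocks => /andP[kM /end_pairs_le[]].
  by rewrite /block_size /=; lia.
have sub : \sum_(d <- osc_blocks opt M) c opt (n - block_size d) <= c opt n.
  have bn : osc_blocks opt n = osc_blocks opt M ++ [seq (k, pq) | k <- iota M (n - M), pq <- end_pairs opt k].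
    rewrite /osc_blocks -[in LHS](@subnKC M n); last by lia.
    by rewrite iotaD map_cat flatten_cat.
  rewrite class_count_osc // natr_sum bn big_cat /= -[leLHS]addr0 lerD ?sumr_ge0 //.
  by rewrite big_seq [leRHS]big_seq_cond le_eqVlt; apply/orP; left; apply/eqP/eq_bigl => d; case: (boolP (d \in _)) => //= /sz ->.
apply: (@le_trans _ _ (b ^+ n * block_series opt M b^-1)).
  by rewrite ler_peMr ?exprn_ge0 // ltW.
rewrite /block_series mulr_sumr.
apply: le_trans (ler_wpM2r (ltW (exprn_gt0 _ b0)) sub); rewrite mulr_suml.
rewrite big_seq [leRHS]big_seq; apply: ler_sum => d /sz dn.
have d1 : (0 < block_size d)%N by rewrite /block_size addn1.
apply: le_trans (IH _ _); last by lia.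
by rewrite exprVn -expfB_cond // gt_eqF.
Qed.
End Growth.

(** * Greedy expansion of the deficit left by the base blocks *)

Section Expansion.
Variable R : realType.
Implicit Types (x y z g : R).

(* The nine values of [ext_pairs], beyond the pairs (2,2) and (2,3), in units of [z ^ 5]. *)
Definition digit z (i : nat) : R :=
  nth 0 [:: 0; z; 1; 1 + z; 1 + 2 * z; 1 + 3 * z; 1 + 3 * z + z ^+ 2;
            1 + 3 * z + 2 * z ^+ 2; 1 + 3 * z + 2 * z ^+ 2 + z ^+ 3] i.

Lemma sum_ext_pairs z i : (i < 9)%N ->
  \sum_(pq <- ext_pairs i.+1) z ^+ (pq.1 + pq.2) = z ^+ 4 + z ^+ 5 + z ^+ 5 * digit z i.
Proof.
do 9?[case: i => [|i]]; last by [].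
all: by move=> _; rewrite /ext_pairs /digit /= !big_cons big_nil /=; ring.
Qed.

Lemma sum_base_pairs z : \sum_(pq <- base_pairs) z ^+ (pq.1 + pq.2) =
  (1 + z) * (1 + z + 2 * z ^+ 2 + 2 * z ^+ 3 + 2 * z ^+ 4).
Proof.
have -> : base_pairs = [:: (0,0); (0,1); (0,2); (0,3); (0,4); (1,0); (1,1); (1,2);
  (1,3); (1,4); (2,0); (2,1); (3,0); (3,1); (4,0); (4,1)]%N by [].
by rewrite !big_cons big_nil /=; ring.
Qed.

(* [1 - z] is the largest gap between consecutive digits; 19 / 8 is an upper bound for [thetaB]. *)
Lemma gap_le z : 8 / 19 <= z <= 1 / 2 ->
  (1 - z) * (1 - z ^+ 2) <= digit z 8 * z ^+ 2.
Proof.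
move=> /andP[z1 _]; rewrite -subr_ge0.
have -> : digit z 8 * z ^+ 2 - (1 - z) * (1 - z ^+ 2) =
    z * (1 + z * (2 + z * (2 + z * (2 + z)))) - 1 by rewrite /digit /=; ring.
(* Horner scheme: a lower bound [c] for the inner factor gives [8 / 19 * c] for the product. The
   fractions below are such products rounded down, loosely enough to be simple and tightly enough to
   end at 1. *)
have step c d w : 0 <= c -> c <= w -> d <= 8 / 19 * c -> d <= z * w.
  move=> c0 cw dc; apply: le_trans dc _; apply: ler_pM => //; lra.
rewrite subr_ge0; apply: (step (145 / 61)); [lra| |lra].
suff : 84 / 61 <= z * (2 + z * (2 + z * (2 + z))) by clear; lra.
apply: (step (193 / 59)); [lra| |lra].
suff : 75 / 59 <= z * (2 + z * (2 + z)) by clear; lra.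
apply: (step (157 / 52)); [lra| |lra].
suff : 53 / 52 <= z * (2 + z) by clear; lra.
by apply: (step (46 / 19)); lra.
Qed.

(** [B] is the value of the expansion that uses the top digit everywhere. By [gap_le] no digit gap
    exceeds [B * z ^+ 2], and above the top digit [B = digit z 8 + B * z ^+ 2], so subtracting the
    largest digit not exceeding [x] leaves a remainder that rescales into [[0, B]]. *)
Lemma digit_choice z B x : 8 / 19 <= z <= 1 / 2 -> B * (1 - z ^+ 2) = digit z 8 ->
  0 <= x <= B -> exists2 i, (i < 9)%N & 0 <= (x - digit z i) / z ^+ 2 <= B.
Proof.
move=> zb BE /andP[x0 xB]; have gap := gap_le zb; case/andP: zb => z1 z2.
have z0 : 0 < z by lra.
have zz : z ^+ 2 <= z * (1 / 2) by rewrite expr2 ler_pM2l.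
have p : 0 < 1 - z ^+ 2 by clear -zz z2; move: (z ^+ 2) zz => a *; lra.
rewrite -BE mulrAC ler_pM2r // in gap.
have BV : B = digit z 8 + B * z ^+ 2 by rewrite -BE; ring.
have zzz : z ^+ 3 <= z ^+ 2 by rewrite exprS ler_piMl ?exprn_ge0 ?ltW //; lra.
have pick i : (i < 9)%N -> digit z i <= x -> x - digit z i <= B * z ^+ 2 ->
    exists2 i, (i < 9)%N & 0 <= (x - digit z i) / z ^+ 2 <= B.
  move=> i9 dx xd; exists i => //; rewrite ler_pdivrMr ?exprn_gt0 // xd andbT.
  by rewrite divr_ge0 ?subr_ge0 // exprn_ge0 // ltW.
suff [i i9] : exists2 i, (i < 9)%N & 0 <= x - digit z i <= B * z ^+ 2.
  by case/andP; rewrite subr_ge0 => *; exact: (pick i).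
clear BE p pick; move: BV; rewrite /digit /=.
move: (B * z ^+ 2) (z ^+ 2) (z ^+ 3) gap zz zzz => W a b *.
have [d1|d1] := ltP x z; first by exists 0%N => //=; lra.
have [d2|d2] := ltP x 1; first by exists 1%N => //=; lra.
have [d3|d3] := ltP x (1 + z); first by exists 2%N => //=; lra.
have [d4|d4] := ltP x (1 + 2 * z); first by exists 3%N => //=; lra.
have [d5|d5] := ltP x (1 + 3 * z); first by exists 4%N => //=; lra.
have [d6|d6] := ltP x (1 + 3 * z + a); first by exists 5%N => //=; lra.
have [d7|d7] := ltP x (1 + 3 * z + 2 * a); first by exists 6%N => //=; lra.
have [d8|d8] := ltP x (1 + 3 * z + 2 * a + b); first by exists 7%N => //=; lra.
by exists 8%N => //=; lra.
Qed.

(** With [z = g^-1] and [f] the bounded product, the base blocks alone leave the deficit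
    [f * z ^+ (2K + 7) / (1 - z)]. Giving (2, 2) and (2, 3) to every path of index above [K] uses up
    this quantity with [f = 1], whence the lower bound 1; the rest is left to the digits, and the
    upper bound keeps it within their reach. *)
Lemma expansion g K : 2 <= g <= 19 / 8 ->
  1 <= thetaB_poly g * g ^+ K.*2 <= 3 / 2 ->
  exists opt C, forall M, (K < M)%N ->
    0 <= 1 - block_series opt M g^-1 <= C * g^-1 ^+ (M.*2 + 1).
Proof.
move=> /andP[g1 g2]; have g0 : 0 < g by lra.
pose z := g^-1; have z0 : 0 < z by rewrite invr_gt0.
have z1 : 8 / 19 <= z by rewrite -[z]mul1r ler_pdivlMr //; lra.
have z2 : z <= 1 / 2 by rewrite -[z]mul1r ler_pdivrMr //; lra.
have p : 0 < 1 - z ^+ 2 by rewrite subr_gt0 exprn_ilt1 //; lra.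
set f := _ * _ => /andP[f1 f2].
have nz2 : 1 - z ^+ 2 != 0 by rewrite gt_eqF.
have nz1 : 1 - z != 0 by rewrite gt_eqF //; lra.
have nz : z != 0 by rewrite gt_eqF.
have zg n : z ^+ n * g ^+ n = 1 by rewrite -exprMn mulVf ?expr1n // gt_eqF.
have fE : thetaB_poly g * z ^+ 7 = f * z ^+ (K.*2 + 7).
  by rewrite /f exprD -mulrA [g ^+ _ * _]mulrA [g ^+ _ * _]mulrC zg mul1r.
(* The right side is [1 - z] times the difference between 1 and the full series of the base blocks;
   this is where the polynomial comes from. *)
have tE : thetaB_poly g * z ^+ 7 =
    1 - 2 * z - z ^+ 3 - z ^+ 4 - 2 * z ^+ 5 - 2 * z ^+ 6 - z ^+ 7.
  by rewrite /thetaB_poly /z; field; rewrite gt_eqF.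
pose B := digit z 8 / (1 - z ^+ 2).
have BE : B * (1 - z ^+ 2) = digit z 8 by rewrite /B divfK.
have [ch chP] : exists ch : R -> nat, forall x, 0 <= x <= B ->
    (ch x < 9)%N /\ 0 <= (x - digit z (ch x)) / z ^+ 2 <= B.
  suff /boolp.choice[ch chP] : forall x, exists i, 0 <= x <= B ->
    (i < 9)%N /\ 0 <= (x - digit z i) / z ^+ 2 <= B by exists ch.
  move=> x.
  case: (boolP (0 <= x <= B)) => [xB|_]; last by exists 0%N.
  by have [|i i9 h] := @digit_choice z B x _ BE xB; [apply/andP|exists i].
(* [xs n] is the remainder of the greedy expansion, in base [z ^- 2], once the paths of index up
   to [K + n] have been treated. *)
pose x0 := (f - 1) / (z * (1 - z)).
pose xs n := iter n (fun x => (x - digit z (ch x)) / z ^+ 2) x0.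
pose opt k := if (k <= K)%N then 0%N else (ch (xs (k - K.+1)%N)).+1.
pose A := (1 + z) * (1 + z + 2 * z ^+ 2 + 2 * z ^+ 3 + 2 * z ^+ 4).
have xsB n : 0 <= xs n <= B.
  elim: n => [|n IH]; last by have [] := chP _ IH.
  rewrite /= /x0 divr_ge0 ?mulr_ge0 //=; try lra.
  rewrite ler_pdivrMr ?mulr_gt0 //; last lra.
  have zp : 0 < 1 + z by lra.
  rewrite -(ler_pM2r zp); have -> : B * (z * (1 - z)) * (1 + z) = z * digit z 8.
    by rewrite -BE; ring.
  (* Here [f - 1 <= 1 / 2] and [1 + z <= 3 / 2], while [43 / 19] is [1 + 3 * z] at [z = 8 / 19], a
     lower bound for the top digit. *)
  apply: (@le_trans _ _ (3 / 4)).
    have -> : 3 / 4 = 1 / 2 * (3 / 2) :> R by lra.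
    by apply: ler_pM; lra.
  apply: (@le_trans _ _ (8 / 19 * (43 / 19))); first lra.
  apply: ler_pM => //; try lra.
  have := exprn_ge0 3 (ltW z0); have := exprn_ge0 2 (ltW z0).
  by rewrite /digit /= => *; lra.
(* Up to index [K] only base pairs occur: what is missing is the final deficit plus the geometric
   tail of the base blocks still to come. *)
have start n : (n <= K)%N -> 1 - block_series opt n.+1 z =
    f * z ^+ (K.*2 + 7) / (1 - z) + A * z ^+ (n.*2 + 3) / (1 - z ^+ 2).
  elim: n => [_|n IH nK].
    rewrite block_seriesS /block_series [osc_blocks _ _]/= big_nil.
    rewrite [end_pairs _ _]/= !big_cons big_nil /= -fE tE /A.
    by field; rewrite nz1 nz2.
  rewrite block_seriesS opprD addrA IH ?(ltnW nK) //.
  have -> : end_pairs opt n.+1 = base_pairs by rewrite /end_pairs /opt nK cats0.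
  rewrite sum_base_pairs -/A.
  rewrite doubleS (_ : (n.*2.+2 + 3 = n.*2 + 3 + 2)%N); last by clear; lia.
  rewrite (_ : (n.*2.+2 + 1 = n.*2 + 3)%N); last by clear; lia.
  by rewrite !exprD; field; rewrite nz2.
(* After index [K] the missing part is the tail of the base pairs and of (2, 2), (2, 3), plus the
   greedy remainder in units of [z ^+ 5]. *)
have inv n : 1 - block_series opt (K.+1 + n) z =
    z ^+ ((K.+1 + n).*2 + 1) * ((A + z ^+ 4 + z ^+ 5) / (1 - z ^+ 2) + z ^+ 5 * xs n).
  elim: n => [|n IH].
    rewrite addn0 start // doubleS (_ : (K.*2.+2 + 1 = K.*2 + 3)%N); last by clear; lia.
    rewrite (_ : (K.*2 + 7 = K.*2 + 3 + 4)%N); last by clear; lia.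
    by rewrite !exprD /= /x0; field; rewrite nz nz1 nz2.
  rewrite addnS block_seriesS opprD addrA IH.
  have -> : end_pairs opt (K.+1 + n) = base_pairs ++ ext_pairs (ch (xs n)).+1.
    by rewrite /end_pairs addSn -addSn /opt leqNgt leq_addr addKn.
  rewrite big_cat /= sum_base_pairs -/A sum_ext_pairs; last by have [] := chP _ (xsB n).
  rewrite -addSn doubleS (_ : ((K.+1 + n).*2.+2 + 1 = (K.+1 + n).*2 + 1 + 2)%N).
    by rewrite !exprD; field; rewrite nz nz2.
  by clear; lia.
exists opt, ((A + z ^+ 4 + z ^+ 5) / (1 - z ^+ 2) + z ^+ 5 * B) => M KM.
have -> : M = (K.+1 + (M - K.+1))%N by clear -KM; lia.
have /andP[xn0 xnB] := xsB (M - K.+1)%N.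
have z0' := ltW z0.
have A0 : 0 <= A by rewrite /A !(mulr_ge0, addr_ge0, exprn_ge0).
rewrite -/z inv; apply/andP; split.
  have p' := ltW p; rewrite mulr_ge0 ?exprn_ge0 // addr_ge0 //.
    by rewrite divr_ge0 // !addr_ge0 ?exprn_ge0.
  by rewrite mulr_ge0 ?exprn_ge0.
by rewrite mulrC ler_wpM2r ?exprn_ge0 // lerD2l ler_wpM2l ?exprn_ge0.
Qed.

(** * Monotonicity and location of the root *)

Lemma thetaB_poly_incr x y : 2 <= x -> x <= y ->
  10 * (y - x) <= thetaB_poly y - thetaB_poly x.
Proof.
(* Taylor expansion at 2: all coefficients after the constant term -37 are nonnegative, and the
   linear one is 10. *)
move=> x2 xy; pose r s : R := 160 * s ^+ 2 + 231 * s ^+ 3 + 159 * s ^+ 4 +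
  60 * s ^+ 5 + 12 * s ^+ 6 + s ^+ 7.
have E w : thetaB_poly w = 10 * (w - 2) - 37 + r (w - 2).
  by rewrite /thetaB_poly /r; ring.
have h n : (x - 2) ^+ n <= (y - 2) ^+ n by rewrite lerXn2r ?nnegrE //; lra.
have : r (x - 2) <= r (y - 2).
  by rewrite /r !lerD ?ler_wpM2l ?ler0n.
by rewrite !E; lra.
Qed.

Lemma thetaB_bounds x : thetaB_poly x = 0 -> 2 <= x < 19 / 8.
Proof.
move=> x0; apply/andP; split.
  rewrite leNgt; apply/negP => x2; have [xn|xp] := leP x 0.
    have e : 0 <= x ^+ 6 by rewrite -[6%N]/(3 * 2)%N exprM sqr_ge0.
    have e7 : 0 <= (- x) * x ^+ 6 by rewrite mulr_ge0 ?oppr_ge0.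
    have q : 0 < x ^+ 4 + x ^+ 3 + 2 * x ^+ 2 + 2 * x + 1.
      have -> : x ^+ 4 + x ^+ 3 + 2 * x ^+ 2 + 2 * x + 1 =
        (x ^+ 2 + x / 2) ^+ 2 + 7 / 4 * (x + 4 / 7) ^+ 2 + 3 / 7 by field.
      apply: ltr_wpDl; last lra.
      by apply: addr_ge0; [exact: sqr_ge0|apply: mulr_ge0; [lra|exact: sqr_ge0]].
    have : 0 < - thetaB_poly x.
      have -> : - thetaB_poly x = (- x * x ^+ 6 + 2 * x ^+ 6) +
        (x ^+ 4 + x ^+ 3 + 2 * x ^+ 2 + 2 * x + 1) by rewrite /thetaB_poly; ring.
      by apply: ltr_wpDl => //; rewrite addr_ge0 // mulr_ge0.
    by rewrite x0 oppr0 ltxx.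
  have : 0 < - thetaB_poly x.
    have -> : - thetaB_poly x = (2 - x) * x ^+ 6 + x ^+ 4 + x ^+ 3 +
      2 * x ^+ 2 + 2 * x + 1 by rewrite /thetaB_poly; ring.
    have xp' := ltW xp; apply: ltr_wpDl; last exact: ltr01.
    by rewrite !addr_ge0 ?mulr_ge0 ?exprn_ge0 // subr_ge0 ltW.
  by rewrite x0 oppr0 ltxx.
rewrite ltNge; apply/negP => hx.
have := @thetaB_poly_incr (19 / 8) x; rewrite x0.
have : 0 < thetaB_poly (19 / 8 : R) by rewrite /thetaB_poly; lra.
move: (thetaB_poly _) => a; clear x0; lra.
Qed.

Lemma thetaB_ivt (v a b : R) n : a <= b -> 0 <= a ->
  thetaB_poly a * a ^+ n <= v <= thetaB_poly b * b ^+ n ->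
  exists2 x, a <= x <= b & thetaB_poly x * x ^+ n = v.
Proof.
move=> ab a0 /andP[va vb].
pose p : {poly R} := ('X^7 - 2 *: 'X^6 - 'X^4 - 'X^3 - 2 *: 'X^2 - 2 *: 'X - 1) * 'X^n - v%:P.
have pE x : p.[x] = thetaB_poly x * x ^+ n - v by rewrite /p /thetaB_poly !(hornerE, hornerXn).
have [|x xab /rootP] := @poly_ivt _ p a b ab.
  by rewrite !pE subr_le0 va subr_ge0.
by rewrite pE => /eqP; rewrite subr_eq0 => /eqP; exists x.
Qed.

End Expansion.

Theorem theorem1 (R : realType) (thetaB : R) (Hroot : thetaB_poly thetaB = 0) :
  forall eps : R, 0 < eps ->
    exists delta1 delta2 : R,
      0 < delta1 /\ delta1 < delta2 /\ delta2 < eps /\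
      forall gamma : R, thetaB + delta1 <= gamma -> gamma <= thetaB + delta2 ->
        exists C : pred (seq nat), perm_class C /\ growth_rate_of C gamma.
Proof.
move=> eps eps0; have /andP[th2 th3] := thetaB_bounds Hroot.
pose d := Num.min (eps / 2) (19 / 8 - thetaB); pose t := thetaB + d.
have d0 : 0 < d by rewrite lt_min; apply/andP; split; lra.
have de : d <= eps / 2 by rewrite ge_min lexx.
have dt : d <= 19 / 8 - thetaB by rewrite ge_min lexx orbT.
have Pt : 0 < thetaB_poly t.
  have := thetaB_poly_incr th2 (_ : thetaB <= t); rewrite Hroot subr0 => h.
  by apply: lt_le_trans (h _); rewrite /t; lra.
have t1 : 1 < t by rewrite /t; lra.
(* A large [K] makes [F], which vanishes at [thetaB], reach 3/2 by the point [t]. The values 1 and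
   3/2, which bound the condition of [expansion], are then both taken in the short interval up to
   [t]. *)
have [K hK] := exprn_unbounded (3 / 2 / thetaB_poly t) t1.
pose F x : R := thetaB_poly x * x ^+ K.*2.
have Ft : 3 / 2 <= F t.
  rewrite /F -ler_pdivrMl // mulrC; apply: le_trans hK _.
  by rewrite ler_weXn2l ?(ltW t1) // -addnn leq_addr.
have Fth : F thetaB = 0 by rewrite /F Hroot mul0r.
have ivt v : 0 <= v <= 3 / 2 -> exists2 x, thetaB <= x <= t & F x = v.
  move=> /andP[v0 v1]; apply: thetaB_ivt; rewrite -?/(F _) ?Fth ?v0 ?(le_trans v1) //.
    by rewrite /t; lra.
  by lra.
have mono x y : thetaB <= x -> x <= y -> F x <= F y.
  move=> tx xy; have P0 u v : thetaB <= u -> u <= v -> thetaB_poly u <= thetaB_poly v.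
    move=> tu uv; have := @thetaB_poly_incr _ u v; have : 2 <= u by lra.
    by move=> -> // /(_ isT uv) h; rewrite -subr_ge0; apply: le_trans h; lra.
  apply: ler_pM; [by rewrite -Hroot P0|by rewrite exprn_ge0 //; lra|exact: P0|].
  by rewrite lerXn2r ?nnegrE //; lra.
have [|g1 /andP[tg1 g1t] Fg1] := ivt 1; first by apply/andP; split; lra.
have [|g2 /andP[tg2 g2t] Fg2] := ivt (3 / 2); first by apply/andP; split; lra.
have g12 : g1 < g2.
  by rewrite ltNge; apply/negP => /(mono _ _ tg2); rewrite Fg1 Fg2; lra.
have tg1' : thetaB < g1.
  by rewrite lt_neqAle tg1 andbT; apply/eqP => e; move: Fg1; rewrite -e Fth; lra.
exists (g1 - thetaB), (g2 - thetaB); split; first by lra.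
split; first by lra.
split; first by rewrite /t in g2t; lra.
move=> g h1 h2; have {h1 h2} [g1g gg2] : g1 <= g /\ g <= g2 by split; lra.
have gb : 2 <= g <= 19 / 8 by apply/andP; split; rewrite /t in g2t; lra.
have g0 : 0 < g by lra.
have Fg : 1 <= thetaB_poly g * g ^+ K.*2 <= 3 / 2.
  by rewrite -/(F g) -{1}Fg1 -Fg2 !mono //; lra.
have [opt [C HC]] := expansion gb Fg.
exists (osc_pred opt); split; first exact: perm_class_osc.
apply: root_cvg; first by lra.
  move=> n; rewrite ler0n /=; apply: class_count_le => // M.
  apply: (@le_trans _ _ (block_series opt (maxn M K.+1) g^-1)).
    by rewrite le_block_series ?leq_maxl // invr_ge0 ltW.
  by have /andP[] := HC (maxn M K.+1) (leq_maxr _ _); rewrite subr_ge0.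
(* For [b < g] the series gains at least [b^-1 - g^-1] on moving from [g^-1] to [b^-1]; for a long
   truncation this outweighs the error [C * g^-1 ^+ (2M + 1)], so the truncated series at [b^-1] is
   at least 1. *)
move=> b /andP[b1 bg]; have b0 : 0 < b by lra.
have D0 : 0 < b^-1 - g^-1 by rewrite subr_gt0 ltf_pV2.
have [|n hn] := @exprn_unbounded _ g (C / (b^-1 - g^-1)); first by lra.
apply: (@class_count_ge _ opt (K.+1 + n)) => //.
have g0' : 0 <= g^-1 by rewrite invr_ge0 ltW.
have gb' : g^-1 <= b^-1 by rewrite -subr_ge0 ltW.
apply: le_trans (block_series_incr opt g0' gb' (_ : 0 < K.+1 + n)%N) => //.
have /andP[_] := HC (K.+1 + n)%N (leq_addr _ _).
have : C * g^-1 ^+ ((K.+1 + n).*2 + 1) <= b^-1 - g^-1.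
  rewrite exprVn ler_pdivrMr ?exprn_gt0 // mulrC -ler_pdivrMr //.
  apply: le_trans hn _; rewrite ler_weXn2l //; [lra|clear; lia].
by move: (block_series _ _ _) (C * _) => x y; clear; lra.
Qed.
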